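(* Let $n\geq 1$ and let $\mathcal F\subseteq\mathcal P([n])$ be a diamond-saturated family. Then $|\mathcal F|\geq\frac{n+1}{5}$.
   Context: $[n]=\{1,\dots,n\}$ and $\mathcal P([n])$ is its power set, ordered by inclusion. The diamond $\mathcal D_2$ is the 4-element poset with one minimal element, one maximal element and two incomparable middle elements (the Boolean lattice of dimension 2). A family $\mathcal F\subseteq\mathcal P([n])$ contains an induced copy of a poset $\mathcal P$ if there is an injection $f:\mathcal P\to\mathcal F$ such that $f(\mathcal P)$, ordered by inclusion, is isomorphic to $\mathcal P$ via $f$. For $\mathcal D_2$ this means there are distinct sets $R,P,Q,A\in\mathcal F$ with $R\subsetneq P\subsetneq A$, $R\subsetneq Q\subsetneq A$ and $P,Q$ incomparable. A family $\mathcal F\subseteq\mathcal P([n])$ is diamond-saturated if it contains no induced copy of $\mathcal D_2$, but for every $S\in\mathcal P([n])\setminus\mathcal F$ the family $\mathcal F\cup\{S\}$ contains an induced copy of $\mathcal D_2$. *)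

(* Defs.v *)
From mathcomp Require Import all_boot all_order all_algebra.

Import Order.DefaultSetSubsetOrder.

Set Implicit Arguments.
Unset Strict Implicit.
Unset Printing Implicit Defensive.

Definition induced_copy (d : Order.disp_t) (P : porderType d) (n : nat)
    (F : {set {set 'I_n}}) : Prop :=
  exists f : P -> {set 'I_n},
    [/\ injective f,
        (forall x : P, f x \in F) &
        (forall x y : P, (f x \subset f y) = (x <= y)%O)].

(* The diamond is the Boolean lattice {set 'I_2}; its inclusion order comes
   from DefaultSetSubsetOrder. *)
Definition diamond : porderType _ := {set 'I_2}.

Definition diamond_saturated (n : nat) (F : {set {set 'I_n}}) : Prop :=
  ~ induced_copy diamond F /\
  (forall S : {set 'I_n}, S \notin F -> induced_copy diamond (S |: F)).

Lemma induced_diamondP (n : nat) (F : {set {set 'I_n}}) :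
  induced_copy diamond F <->
  exists R P Q A : {set 'I_n},
    [/\ [/\ R \in F, P \in F, Q \in F & A \in F],
        R \proper P /\ P \proper A,
        R \proper Q /\ Q \proper A &
        ~~ (P \subset Q) /\ ~~ (Q \subset P)].
Proof.
have o10 : (lift ord0 ord0 : 'I_2) != ord0 by [].
split.
  case=> f [_ fF fle].
  have fs (X Y : {set 'I_2}) : (f X \subset f Y) = (X \subset Y).
    by rewrite fle Order.SetSubsetOrder.leEsubset.
  exists (f set0), (f [set ord0]), (f [set lift ord0 ord0]), (f setT).
  have pr (X Y : {set 'I_2}) : X \proper Y -> f X \proper f Y.
    by rewrite !properE !fs.
  split; first by split; apply: fF.
  - by split; apply: pr; rewrite properEcard ?sub0set ?subsetT ?cards0 ?cards1 ?cardsT ?card_ord.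
  - by split; apply: pr; rewrite properEcard ?sub0set ?subsetT ?cards0 ?cards1 ?cardsT ?card_ord.
  - by rewrite !fs !sub1set !inE.
case=> R [P [Q [A [[RF PF QF AF] [RP PA] [RQ QA] [nPQ nQP]]]]].
pose g (X : {set 'I_2}) : {set 'I_n} :=
  if ord0 \in X then (if lift ord0 ord0 \in X then A else P)
  else (if lift ord0 ord0 \in X then Q else R).
have sub2 (X Y : {set 'I_2}) : (X \subset Y) =
  ((ord0 \in X) ==> (ord0 \in Y)) &&
  ((lift ord0 ord0 \in X) ==> (lift ord0 ord0 \in Y)).
  apply/subsetP/andP => [sXY | [/implyP s0 /implyP s1] i].
    by split; apply/implyP; apply: sXY.
  by case: (unliftP ord0 i) => [j|] -> //; rewrite [j]ord1.
have RA := proper_trans RP PA.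
have gs X Y : (g X \subset g Y) = (X \subset Y).
  rewrite sub2 /g.
  case: (ord0 \in X); case: (lift ord0 ord0 \in X);
  case: (ord0 \in Y); case: (lift ord0 ord0 \in Y);
  rewrite /= ?subxx //; try (by rewrite proper_sub);
  by apply/negbTE => //; move: RP PA RQ QA RA; rewrite !properE;
     do ![case/andP=> _ ?].
exists g; split.
- by move=> X Y eXY; apply/eqP; rewrite eqEsubset -!gs eXY subxx.
- by move=> X; rewrite /g; case: ifP => _; case: ifP => _.
- by move=> X Y; rewrite gs Order.SetSubsetOrder.leEsubset.
Qed.

(* Main.v *)
Require Import Defs.
From mathcomp Require Import all_boot all_order all_algebra.
From mathcomp Require Import zify.
Import Order.TTheory GRing.Theory Num.Theory.
Local Open Scope ring_scope.

Set Implicit Arguments.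
Unset Strict Implicit.
Unset Printing Implicit Defensive.

(** Call a weight w : [n] -> rat balanced when every member of F, and [n]
    itself, has total weight 0.  Balanced weights vanish, so the indicator
    vectors of [n] and of the members of F span rat^n, whence n <= #|F| + 1;
    as F is nonempty, this is stronger than n + 1 <= 5 #|F|.

    By saturation, a set S containing no member of F lies in P :&: Q for two
    members P, Q whose intersection contains no member either.  Let R be a
    minimal member on which w does not vanish, and take for S the points of
    positive weight together with the points of R of weight 0.  A member inside
    S would have only nonnegative points, hence only points of weight 0, and so
    would be a proper subset of R.  For P and Q as above, ~: P and ~: Q have
    total weight 0 and no positive point, hence only points of weight 0, so R
    lies in P :&: Q, a contradiction.  Thus w vanishes on minimal members and,
    by complementation, off maximal members.

    A point x with w x != 0 therefore lies in every maximal and in no minimal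
    member.  If C is maximal among the members avoiding x, then x |: C is again
    a member, and w x is the difference of two weights equal to 0. *)

Section Complements.
Variable T : finType.
Implicit Types (A C : {set T}) (F : {set {set T}}).

Definition complements F : {set {set T}} := [set ~: C | C in F].

Lemma mem_complements F C : (C \in complements F) = (~: C \in F).
Proof. by rewrite -{1}[C]setCK mem_imset //; apply: setC_inj. Qed.

Lemma complementsK F : complements (complements F) = F.
Proof. by apply/setP=> C; rewrite !mem_complements setCK. Qed.

Lemma maxset_complements F A :
  maxset [in F] A = minset [in complements F] (~: A).
Proof.
by rewrite maxminset; apply: minset_eq => C; rewrite !inE mem_complements.
Qed.

End Complements.

Section Weights.
Variable T : finType.
Implicit Types (C P : {set T}) (F : {set {set T}}).

Definition weight (V : nmodType) (w : T -> V) C : V := \sum_(x in C) w x.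

Definition balanced (V : nmodType) (w : T -> V) F : Prop :=
  {in setT |: F, forall C, weight w C = 0}.

Lemma weightU1 (V : nmodType) (w : T -> V) x C :
  x \notin C -> weight w (x |: C) = w x + weight w C.
Proof. exact: big_setU1. Qed.

Lemma weight_setC (V : nmodType) (w : T -> V) C :
  weight w C + weight w (~: C) = weight w setT.
Proof. by rewrite /weight [RHS](big_setID C) /= setTI setTD. Qed.

Lemma balanced_mem (V : nmodType) (w : T -> V) F C :
  balanced w F -> C \in F -> weight w C = 0.
Proof. by move=> wF CF; apply: wF; rewrite inE CF orbT. Qed.

Lemma balanced_memC (V : zmodType) (w : T -> V) F C :
  balanced w F -> C \in F -> weight w (~: C) = 0.
Proof.
move=> wF CF; have := weight_setC w C.
by rewrite (balanced_mem wF CF) add0r (wF setT) ?setU11.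
Qed.

Lemma balanced_complements (V : zmodType) (w : T -> V) F :
  balanced w F -> balanced w (complements F).
Proof.
move=> wF C; case/setU1P=> [->|/imsetP[D DF ->]]; first exact: wF (setU11 _ _).
exact: balanced_memC DF.
Qed.

Lemma balanced_support_sub (R : realDomainType) (w : T -> R) F P :
  balanced w F -> P \in F -> [set x | 0 < w x] \subset P ->
  [set x | w x != 0] \subset P.
Proof.
move=> wF PF /subsetP pos_sub; apply/subsetP=> x; rewrite inE.
apply: contraR => xP; rewrite -oppr_eq0.
have w_le0 y : y \in ~: P -> 0 <= - w y.
  rewrite inE oppr_ge0 leNgt; apply: contra => wy.
  by apply: pos_sub; rewrite inE.
apply/eqP/(psumr_eq0P w_le0); last by rewrite inE.
by rewrite sumrN [X in - X](balanced_memC wF PF) oppr0.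
Qed.

Lemma leq_card_determining (K : fieldType) F :
  (forall w : T -> K, {in F, forall C, weight w C = 0} -> w =1 fun=> 0) ->
  (#|T| <= #|F|)%N.
Proof.
move=> det.
pose incidence : 'M[K]_(#|T|, #|F|) :=
  \matrix_(i, j) ((enum_val i : T) \in (enum_val j : {set T}))%:R.
suff : row_free incidence by move/eqP <-; apply: rank_leq_col.
apply: inj_row_free => v v0; apply/rowP=> i; rewrite mxE.
have := det (fun x => v 0 (enum_rank x)) _ (enum_val i).
rewrite enum_valK; apply=> C CF.
have := congr1 (fun u : 'rV_ _ => u 0 (enum_rank_in CF C)) v0.
rewrite !mxE => <-; rewrite /weight (reindex _ (onW_bij _ (enum_val_bij T))) /=.
rewrite big_mkcond; apply: eq_bigr => k _.
rewrite mxE enum_rankK_in // enum_valK.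
by case: (_ \in C); rewrite ?mulr1 ?mulr0.
Qed.

End Weights.

Section DiamondSets.
Variable T : finType.
Implicit Types R P Q A : {set T}.

(* The inclusions are strict because P and Q are incomparable. *)
Definition is_diamond R P Q A : Prop :=
  [/\ R \subset P :&: Q, P :|: Q \subset A, ~~ (P \subset Q) &
      ~~ (Q \subset P)].

Lemma is_diamond_sym R P Q A : is_diamond R P Q A -> is_diamond R Q P A.
Proof. by case=> RPQ PQA nPQ nQP; split; rewrite // (setIC, setUC). Qed.

Lemma is_diamond_setC R P Q A :
  is_diamond R P Q A -> is_diamond (~: A) (~: P) (~: Q) (~: R).
Proof. by case=> RPQ PQA nPQ nQP; split; rewrite -?setCU -?setCI ?setCS. Qed.

Lemma is_diamond_neq R P Q A : is_diamond R P Q A ->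
  [/\ R != P /\ P != A, R != Q /\ Q != A, R != A & P != Q].
Proof.
rewrite /is_diamond subsetI subUset.
case=> /andP[RP RQ] /andP[PA QA] nPQ nQP; split; [split|split| |].
- by apply: contraNneq nPQ => <-.
- by apply: contraNneq nQP => ->.
- by apply: contraNneq nQP => <-.
- by apply: contraNneq nPQ => ->.
- by apply: contraNneq nPQ => RA; apply: subset_trans PA _; rewrite -RA.
- by apply: contraNneq nPQ => ->.
Qed.

End DiamondSets.

Section InducedDiamonds.
Variable n : nat.
Implicit Types (R P Q A S : {set 'I_n}) (F : {set {set 'I_n}}).

Lemma induced_is_diamondP F : induced_copy diamond F <->
  exists R P Q A,
    [/\ R \in F, P \in F, Q \in F & A \in F] /\ is_diamond R P Q A.
Proof.
rewrite induced_diamondP; split; case=> R [P [Q [A]]].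
  case=> inF [RP PA] [RQ QA] [nPQ nQP]; exists R, P, Q, A; split=> //.
  by split; rewrite // (subsetI, subUset) !proper_sub.
case=> inF dia; have [[RP PA] [RQ QA] _ _] := is_diamond_neq dia.
case: dia; rewrite subsetI subUset => /andP[sRP sRQ] /andP[sPA sQA] nPQ nQP.
by exists R, P, Q, A; split=> //; rewrite !properEneq ?(RP, PA) ?(RQ, QA).
Qed.

Lemma induced_diamondI F R P Q A : R \in F -> P \in F -> Q \in F -> A \in F ->
  is_diamond R P Q A -> induced_copy diamond F.
Proof.
by move=> RF PF QF AF dia; apply/induced_is_diamondP; exists R, P, Q, A.
Qed.

Lemma induced_diamondU1 F S :
  ~ induced_copy diamond F -> induced_copy diamond (S |: F) ->
  [\/ exists P Q A, [/\ P \in F, Q \in F & A \in F] /\ is_diamond S P Q A,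
      exists R Q A, [/\ R \in F, Q \in F & A \in F] /\ is_diamond R S Q A |
      exists R P Q, [/\ R \in F, P \in F & Q \in F] /\ is_diamond R P Q S].
Proof.
move=> free /induced_is_diamondP[R [P [Q [A [[RF PF QF AF] dia]]]]].
have [[RP PA] [RQ QA] RA PQ] := is_diamond_neq dia.
have inF X Y : Y = S -> X != Y -> X \in S |: F -> X \in F.
  by move=> <- XY; rewrite in_setU1 (negPf XY).
have [RS|RS] := eqVneq R S.
  by constructor 1; exists P, Q, A; rewrite -RS; split=> //;
    split; apply: (inF _ R); rewrite // eq_sym.
have [AS|AS] := eqVneq A S.
  by constructor 3; exists R, P, Q; rewrite -AS; split=> //;
    split; apply: (inF _ A).
have [PS|PS] := eqVneq P S.
  by constructor 2; exists R, Q, A; rewrite -PS; split=> //;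
    split; apply: (inF _ P); rewrite // eq_sym.
have [QS|QS] := eqVneq Q S.
  constructor 2; exists R, P, A; rewrite -QS; split; last exact: is_diamond_sym.
  by split; apply: (inF _ Q); rewrite // eq_sym.
by case: free; apply: induced_diamondI dia; apply: (inF _ S).
Qed.

Lemma induced_diamond_complements F :
  induced_copy diamond F -> induced_copy diamond (complements F).
Proof.
case/induced_is_diamondP=> R [P [Q [A [[RF PF QF AF] /is_diamond_setC dia]]]].
by apply: induced_diamondI dia; apply: imset_f.
Qed.

Lemma diamond_saturated_complements F :
  diamond_saturated F -> diamond_saturated (complements F).
Proof.
move=> [free sat]; split=> [|S].
  by move/induced_diamond_complements; rewrite complementsK.
rewrite mem_complements => /sat/induced_diamond_complements.
by rewrite /complements imsetU1 setCK.
Qed.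

End InducedDiamonds.

Section SaturatedFamilies.
Variables (n : nat) (F : {set {set 'I_n}}).
Hypothesis satF : diamond_saturated F.
Implicit Types (R P Q A S C : {set 'I_n}).

Lemma diamond_saturated_neq0 : F != set0.
Proof.
case: satF => free sat; apply/eqP=> F0.
have /sat/(induced_diamondU1 free) : set0 \notin F by rewrite F0 inE.
by case; case=> X [Y [Z [[]]]]; rewrite F0 inE.
Qed.

Lemma diamond_saturated_sub_setI S : {in F, forall C, ~~ (C \subset S)} ->
  exists P Q, [/\ P \in F, Q \in F, S \subset P :&: Q &
    {in F, forall C, ~~ (C \subset P :&: Q)}].
Proof.
case: satF => free sat S_no_member.
have /sat/(induced_diamondU1 free)[] : S \notin F.
- by apply/negP=> SF; have := S_no_member _ SF; rewrite subxx.
- case=> P [Q [A [[PF QF AF] [SPQ PQA nPQ nQP]]]].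
  exists P, Q; split=> // C CF; apply/negP=> CPQ.
  by apply: free; apply: (@induced_diamondI _ _ C P Q A).
- case=> R [Q [A [[RF _ _] [RSQ _ _ _]]]].
  by have := S_no_member _ RF; rewrite (subset_trans RSQ (subsetIl _ _)).
- case=> R [P [Q [[_ PF _] [_ PQS _ _]]]].
  by have := S_no_member _ PF; rewrite (subset_trans (subsetUl _ _) PQS).
Qed.

Lemma diamond_saturated_exists_setU1 x :
  (forall R, minset [in F] R -> x \notin R) ->
  (forall A, maxset [in F] A -> x \in A) ->
  exists C, [/\ C \in F, x \notin C & x |: C \in F].
Proof.
case: satF => free sat x_min x_max.
have /set0Pn[C0 C0F] := diamond_saturated_neq0.
have [R0 R0min _] := @minset_exists _ [in F] _ C0F.
pose avoiding C := (C \in F) && (x \notin C).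
have avR0 : avoiding R0 by rewrite /avoiding (minsetp R0min) x_min.
have [C /maxsetP[/andP[CF xC] Cmax] _] := maxset_exists avR0.
exists C; split=> //; apply: contraT => nS.
have CS : C \subset x |: C := subsetUr _ _.
case: (free); case/(induced_diamondU1 free): (sat _ nS).
- case=> P [Q [A [[PF QF AF] [SPQ PQA nPQ nQP]]]].
  apply: (@induced_diamondI _ _ C P Q A) => //; split=> //.
  exact: subset_trans CS SPQ.
- case=> R [Q [A [[RF QF AF] []]]].
  rewrite subsetI => /andP[RS RQ] SQA nSQ nQS.
  have [R1 R1min R1R] := @minset_exists _ [in F] _ RF.
  apply: (@induced_diamondI _ _ R1 C Q A) => //; first exact: minsetp R1min.
  split.
  + rewrite subsetI (subset_trans R1R RQ) andbT -(setU1K xC).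
    by rewrite subsetD1 (subset_trans R1R RS) x_min.
  + by apply: subset_trans SQA; rewrite setSU.
  + apply: contra nQS => CQ; suff -> : Q = C by [].
    apply: Cmax => //; rewrite /avoiding QF.
    by apply: contra nSQ => xQ; rewrite subUset sub1set xQ.
  + by apply: contra nQS => /subset_trans; apply.
- case=> R [P [Q [[RF PF QF] [RPQ PQS nPQ nQP]]]].
  have [A Amax CA] := @maxset_exists _ [in F] _ CF.
  apply: (@induced_diamondI _ _ R P Q A) => //; first exact: maxsetp Amax.
  by split=> //; apply: subset_trans PQS _; rewrite subUset sub1set x_max.
Qed.

Lemma balanced_minset_eq0 (K : realDomainType) (w : 'I_n -> K) R :
  balanced w F -> minset [in F] R -> {in R, forall x, w x = 0}.
Proof.
move=> wF /minsetP[RF Rmin] x xR; apply/eqP; apply: contraT => wx.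
pose supp := [set y | w y != 0].
pose S := [set y | 0 < w y] :|: (R :\: supp).
have S_no_member : {in F, forall C, ~~ (C \subset S)}.
  move=> C CF; apply/negP=> /subsetP CS.
  have w_ge0 y : y \in C -> 0 <= w y.
    by move/CS; rewrite !inE negbK => /orP[/ltW //|/andP[/eqP ->]].
  have w0 := psumr_eq0P w_ge0 (balanced_mem wF CF).
  have CR : C \subset R.
    by apply/subsetP=> y yC; have := CS y yC; rewrite !inE w0 // ltxx eqxx.
  by move: wx; rewrite w0 ?eqxx // (Rmin C CF CR).
have supp_sub P : P \in F -> S \subset P -> supp \subset P.
  move=> PF SP; apply: balanced_support_sub wF PF _.
  exact: subset_trans (subsetUl _ _) SP.
have [P [Q [PF QF SPQ /(_ _ RF)/negP[]]]] :=
  diamond_saturated_sub_setI S_no_member.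
have R_sub : R \subset S :|: supp.
  by rewrite setUC -subDset subsetUr.
apply: subset_trans R_sub _; rewrite subUset SPQ.
by move: SPQ; rewrite !subsetI => /andP[SP SQ]; rewrite !supp_sub.
Qed.

End SaturatedFamilies.

Lemma balanced_maxset_eq0 n (F : {set {set 'I_n}}) (K : realDomainType)
    (w : 'I_n -> K) A :
  diamond_saturated F -> balanced w F -> maxset [in F] A ->
  {in ~: A, forall x, w x = 0}.
Proof.
move=> satF wF; rewrite maxset_complements.
apply: balanced_minset_eq0; last exact: balanced_complements.
exact: diamond_saturated_complements.
Qed.

Lemma balanced_eq0 n (F : {set {set 'I_n}}) (K : realDomainType)
    (w : 'I_n -> K) :
  diamond_saturated F -> balanced w F -> w =1 fun=> 0.
Proof.
move=> satF wF x; apply/eqP/negPn/negP=> /eqP wx.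
have [||C [CF xC xCF]] := diamond_saturated_exists_setU1 satF (x := x).
- by move=> R Rmin; apply/negP=> /(balanced_minset_eq0 satF wF Rmin).
- move=> A Amax; rewrite -[A]setCK inE; apply/negP.
  by move/(balanced_maxset_eq0 satF wF Amax).
apply: wx; have := weightU1 w xC.
by rewrite (balanced_mem wF CF) (balanced_mem wF xCF) addr0.
Qed.

Lemma leq_card_diamond_saturated n (F : {set {set 'I_n}}) :
  diamond_saturated F -> (n <= #|F|.+1)%N.
Proof.
move=> satF; rewrite -[n in (n <= _)%N]card_ord.
apply: leq_trans (_ : #|setT |: F| <= _)%N.
  by apply: (@leq_card_determining _ rat) => w; apply: balanced_eq0.
by rewrite cardsU1 -add1n leq_add2r leq_b1.
Qed.

Theorem theorem1 (n : nat) (hn : (1 <= n)%N) (F : {set {set 'I_n}})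
    (hF : diamond_saturated F) :
  (n%:R + 1) / 5%:R <= #|F|%:R :> rat.
Proof.
have n_le := leq_card_diamond_saturated hF.
have := diamond_saturated_neq0 hF; rewrite -card_gt0 => F_gt0.
by rewrite ler_pdivrMr // natr1 -natrM ler_nat; lia.
Qed.
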